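(* Let $\Bbbk$ be a field of characteristic $0$, let $n=2a$ with $a\ge2$ an integer, and let $\Delta$ be the cycle on $n$ vertices, regarded as a $1$-dimensional simplicial complex. Let $R=A(\Delta)=\Bbbk[x_1,\ldots,x_n]/\langle x_1^2,\ldots,x_n^2,I_\Delta\rangle$, where $I_\Delta$ is the Stanley-Reisner ideal of $\Delta$, let $\omega$ be the graded canonical module of $R$, and let $\tilde R=R\ltimes\omega(-3)$ be the Nagata idealization. Then $\tilde R$ is an Artinian Gorenstein algebra which is a quotient of a polynomial ring in $2n$ variables, has the unimodal Hilbert function $(1,2n,2n,1)$, and fails the Weak Lefschetz Property (WLP) in degree $1$.
   Context: The cycle on vertices $1,\ldots,n$ is the simplicial complex with facets $\{1,2\},\{2,3\},\ldots,\{n-1,n\},\{1,n\}$. The Stanley-Reisner ideal is $I_\Delta=\langle x_{i_1}\cdots x_{i_m} : \{i_1,\ldots,i_m\}\notin\Delta\rangle$. The ring $R=A(\Delta)$ is a standard graded Artinian level $\Bbbk$-algebra of socle degree $2$ (its socle is $R_2$). Its graded canonical module is $\omega=\operatorname{Hom}_\Bbbk(R,\Bbbk)$, graded by $\omega_{-j}=\operatorname{Hom}_\Bbbk(R_j,\Bbbk)$, and $\omega(-3)_i=\omega_{i-3}$. The Nagata idealization $R\ltimes\omega(-3)$ is the graded $\Bbbk$-vector space $R\oplus\omega(-3)$ with multiplication $(r,u)(s,v)=(rs,\,rv+su)$. It is a standard graded quotient of $\Bbbk[x_1,\ldots,x_n,y_1,\ldots,y_n]$, where $y_1,\ldots,y_n$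 correspond to the $n$ generators of $\omega$. WLP holds for a standard graded Artinian algebra $B$ in degree $i$ if, for a general linear form $\ell\in B_1$, the multiplication map $\times\ell: B_i\to B_{i+1}$ is injective or surjective; otherwise $B$ fails WLP in degree $i$. *)

(* Defs.v *)
From HB Require Import structures.
From mathcomp Require Import all_boot all_order all_algebra.
From mathcomp Require Import generic_quotient ring_quotient.
From mathcomp Require boolp.
From mathcomp.multinomials Require Import mpoly.

Set Implicit Arguments.
Unset Strict Implicit.
Unset Printing Implicit Defensive.

Import GRing.Theory.
Local Open Scope ring_scope.
Local Open Scope quotient_scope.

Record simplicial_complex (T : finType) := SimplicialComplex {
  faces :> {set {set T}};
  faces0 : set0 \in faces;
  faces_sub : forall F G : {set T}, F \subset G -> G \in faces -> F \in faces
}.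

(* The empty set is a face even when there are no facets. *)
Definition facet_faces (T : finType) (S : {set {set T}}) : {set {set T}} :=
  [set F | (F == set0) || [exists E in S, F \subset E]].

Lemma facet_faces0 (T : finType) (S : {set {set T}}) : set0 \in facet_faces S.
Proof. by rewrite inE eqxx. Qed.

Lemma facet_faces_sub (T : finType) (S : {set {set T}}) (F G : {set T}) :
  F \subset G -> G \in facet_faces S -> F \in facet_faces S.
Proof.
move=> sFG; rewrite !inE => /orP[/eqP G0|/existsP[E /andP[ES sGE]]].
  by move: sFG; rewrite G0 subset0 => ->.
by apply/orP; right; apply/existsP; exists E; rewrite ES (subset_trans sFG).
Qed.

Definition complex_of_facets (T : finType) (S : {set {set T}}) :=
  SimplicialComplex (facet_faces0 S) (@facet_faces_sub T S).

(* Vertices are numbered 0, ..., n-1, and ordS is the successor modulo n. *)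
Definition cycle_complex (n : nat) : simplicial_complex 'I_n :=
  complex_of_facets [set [set i; ordS i] | i : 'I_n].

Definition ideal_gen (A : comNzRingType) (G : A -> Prop) (p : A) : Prop :=
  exists2 s : seq (A * A),
    (forall q, q \in s -> G q.2) & p = \sum_(q <- s) q.1 * q.2.

Definition nonface_monomial (k : fieldType) (n : nat)
    (D : simplicial_complex 'I_n) (p : {mpoly k[n]}) : Prop :=
  exists2 F : {set 'I_n}, F \notin D & p = \prod_(i in F) 'X_i.

Definition stanley_reisner (k : fieldType) (n : nat)
    (D : simplicial_complex 'I_n) : {mpoly k[n]} -> Prop :=
  ideal_gen (@nonface_monomial k n D).

Definition face_ideal_gens (k : fieldType) (n : nat)
    (D : simplicial_complex 'I_n) (p : {mpoly k[n]}) : Prop :=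
  (exists i : 'I_n, p = 'X_i ^+ 2) \/ stanley_reisner D p.

Definition face_ideal (k : fieldType) (n : nat)
    (D : simplicial_complex 'I_n) : {pred {mpoly k[n]}} :=
  fun p => boolp.asbool (ideal_gen (@face_ideal_gens k n D) p).

Arguments face_ideal k {n} D.

Section FaceIdeal.
Variables (k : fieldType) (n : nat) (D : simplicial_complex 'I_n).

Lemma face_ideal_eval0 (p : {mpoly k[n]}) :
  p \in face_ideal k D -> p.@[fun=> 0] = 0.
Proof.
move=> /boolp.asboolP[s sG ->].
rewrite (raddf_sum (meval (fun=> 0))) big_seq big1 // => q /sG qG.
rewrite [LHS]rmorphM /=; suff -> : (q.2).@[fun=> 0] = 0 by rewrite mulr0.
case: qG => [[i ->]|[t tG ->]]; first by rewrite rmorphXn /= mevalXU expr0n.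
rewrite (raddf_sum (meval (fun=> 0))) big_seq big1 // => r /tG[F FD E].
rewrite [LHS]rmorphM /= E rmorph_prod.
have [F0|[i iF]] := set_0Vmem F; first by rewrite F0 faces0 in FD.
by rewrite (bigD1 i iF) /= mevalXU mul0r mulr0.
Qed.

Lemma face_ideal_closed : idealr_closed (face_ideal k D).
Proof.
split.
- by apply/boolp.asboolP; exists [::] => //; rewrite big_nil.
- by apply/negP => /face_ideal_eval0/eqP; rewrite meval1 oner_eq0.
- move=> a u v /boolp.asboolP[s sG ->] /boolp.asboolP[t tG ->].
  apply/boolp.asboolP; exists ([seq (a * q.1, q.2) | q <- s] ++ t).
    by move=> q; rewrite mem_cat => /orP[/mapP[r /sG rG ->]|/tG].
  rewrite big_cat big_map /= mulr_sumr; congr (_ + _).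
  by apply: eq_bigr => q _; rewrite mulrA.
Qed.

HB.instance Definition _ :=
  isIdealr.Build {mpoly k[n]} (face_ideal k D) face_ideal_closed.

End FaceIdeal.

Section QuotientAlgebra.
Variables (k : fieldType) (A : comAlgType k) (I : idealr A).
Local Notation Q := {ideal_quot I}.

Definition quot_scale (c : k) (x : Q) : Q := \pi_Q (c *: repr x).

Lemma quot_scaleE (c : k) (a : A) : quot_scale c (\pi_Q a) = \pi_Q (c *: a).
Proof.
apply/eqP; rewrite /quot_scale -Quotient.idealrBE -scalerBr -mulr_algl.
by apply: idealMr; rewrite Quotient.idealrBE reprK.
Qed.

Lemma quot_scalerA a b v :
  quot_scale a (quot_scale b v) = quot_scale (a * b) v.
Proof.
by elim/quotW: v => v; rewrite (quot_scaleE b) (quot_scaleE a) quot_scaleE scalerA.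
Qed.

Lemma quot_scale1r : left_id 1 quot_scale.
Proof. by elim/quotW => v; rewrite quot_scaleE scale1r. Qed.

Lemma quot_scalerDr : right_distributive quot_scale +%R.
Proof.
move=> a; elim/quotW => u; elim/quotW => v.
by rewrite -rmorphD (quot_scaleE a u) (quot_scaleE a v) quot_scaleE scalerDr rmorphD.
Qed.

Lemma quot_scalerDl v : {morph quot_scale^~ v : a b / a + b}.
Proof.
elim/quotW: v => v a b.
by rewrite (quot_scaleE a) (quot_scaleE b) quot_scaleE scalerDl rmorphD.
Qed.

HB.instance Definition _ := GRing.Zmodule_isLmodule.Build k Q
  quot_scalerA quot_scale1r quot_scalerDr quot_scalerDl.

Lemma quot_scalerAl (c : k) (u v : Q) : c *: (u * v) = (c *: u) * v.
Proof.
elim/quotW: u => u; elim/quotW: v => v; rewrite -rmorphM.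
rewrite [LHS]quot_scaleE scalerAl rmorphM; congr (_ * _); exact: esym (quot_scaleE c u).
Qed.

HB.instance Definition _ := GRing.Lmodule_isLalgebra.Build k Q quot_scalerAl.
HB.instance Definition _ := GRing.Lalgebra_isComAlgebra.Build k Q.

End QuotientAlgebra.

Definition face_algebra (k : fieldType) (n : nat)
    (D : simplicial_complex 'I_n) : Type :=
  {ideal_quot (face_ideal k D)}.

HB.instance Definition _ (k : fieldType) (n : nat)
  (D : simplicial_complex 'I_n) := GRing.ComAlgebra.on (face_algebra k D).

Definition face_pi (k : fieldType) (n : nat) (D : simplicial_complex 'I_n)
    (p : {mpoly k[n]}) : face_algebra k D :=
  \pi_{ideal_quot (face_ideal k D)} p.

Definition face_deg (k : fieldType) (n : nat) (D : simplicial_complex 'I_n)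
    (d : nat) (x : face_algebra k D) : Prop :=
  exists2 p : {mpoly k[n]}, p \is d.-homog & x = face_pi D p.

(* Hom_k(A, k), made an A-module by (a f)(x) = f(a x). *)
Definition dual (k : fieldType) (A : comAlgType k) : Type :=
  {linear A -> k^o}.

Section Dual.
Variables (k : fieldType) (A : comAlgType k).

HB.instance Definition _ := boolp.gen_eqMixin (dual A).
HB.instance Definition _ := boolp.gen_choiceMixin (dual A).

Definition dual_app (f : dual A) : A -> k := GRing.Linear.sort f.

Lemma dualP (f g : dual A) : dual_app f =1 dual_app g -> f = g.
Proof.
case: f g => [f cf] [g cg]; rewrite /dual_app /= => /boolp.funext fg.
move: cf cg; rewrite fg => -[[a] [b]] [[c] [d]].
by rewrite (boolp.Prop_irrelevance a c) (boolp.Prop_irrelevance b d).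
Qed.

Definition dual_zero : dual A := \0 : {linear A -> k^o}.
Definition dual_opp (f : dual A) : dual A :=
  (\- (f : {linear A -> k^o})) : {linear A -> k^o}.
Definition dual_add (f g : dual A) : dual A :=
  ((f : {linear A -> k^o}) \+ (g : {linear A -> k^o})) : {linear A -> k^o}.

Lemma dual_addA : associative dual_add.
Proof. by move=> f g h; apply: dualP => x; rewrite /dual_app /= addrA. Qed.
Lemma dual_addC : commutative dual_add.
Proof. by move=> f g; apply: dualP => x; rewrite /dual_app /= addrC. Qed.
Lemma dual_add0 : left_id dual_zero dual_add.
Proof. by move=> f; apply: dualP => x; rewrite /dual_app /= add0r. Qed.
Lemma dual_addN : left_inverse dual_zero dual_opp dual_add.
Proof. by move=> f; apply: dualP => x; rewrite /dual_app /= addNr. Qed.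

HB.instance Definition _ := GRing.isZmodule.Build (dual A)
  dual_addA dual_addC dual_add0 dual_addN.

Definition dual_scale_fun (a : A) (f : dual A) : A -> k^o :=
  fun x => dual_app f (a * x).

Lemma dual_scale_linear a f : linear (dual_scale_fun a f).
Proof.
move=> c x y; rewrite /dual_scale_fun /dual_app mulrDr -scalerAr.
exact: (linearP f).
Qed.

HB.instance Definition _ a f :=
  GRing.isLinear.Build k A k^o _ (dual_scale_fun a f) (dual_scale_linear a f).

Definition dual_scale (a : A) (f : dual A) : dual A :=
  dual_scale_fun a f : {linear A -> k^o}.

Lemma dual_scalerA a b f : dual_scale a (dual_scale b f) = dual_scale (a * b) f.
Proof.
apply: dualP => x; rewrite /dual_app /= /dual_scale_fun /dual_app /=.
by rewrite /dual_scale_fun mulrA [b * a]mulrC.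
Qed.
Lemma dual_scale1r : left_id 1 dual_scale.
Proof.
by move=> f; apply: dualP => x; rewrite /dual_app /= /dual_scale_fun mul1r.
Qed.
Lemma dual_scalerDr : right_distributive dual_scale +%R.
Proof. by move=> a f g; apply: dualP => x. Qed.
Lemma dual_scalerDl f : {morph dual_scale^~ f : a b / a + b}.
Proof.
move=> a b; apply: dualP => x; rewrite /dual_app /= /dual_scale_fun.
by rewrite mulrDl /dual_app (raddfD (f : {linear A -> k^o})).
Qed.

HB.instance Definition _ := GRing.Zmodule_isLmodule.Build A (dual A)
  dual_scalerA dual_scale1r dual_scalerDr dual_scalerDl.

End Dual.

(* Functionals on the degree-j component of A are identified with those on A
   that vanish on every other component; they sit in degree -j. *)
Definition canonical_deg (k : fieldType) (A : comAlgType k)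
    (gA : nat -> A -> Prop) (d : int) (f : dual A) : Prop :=
  forall (j : nat) (x : A), gA j x -> - j%:Z != d -> dual_app f x = 0.

Definition shift_deg (M : Type) (gM : int -> M -> Prop) (s : int) :
    int -> M -> Prop :=
  fun d => gM (d + s).

Definition idealization (k : fieldType) (A : comAlgType k) (M : lmodType A) :
    Type := (A * M)%type.

Section Idealization.
Variables (k : fieldType) (A : comAlgType k) (M : lmodType A).
Local Notation B := (idealization M).

HB.instance Definition _ := GRing.Zmodule.copy B (A * M)%type.

Definition idz_one : B := (1, 0).
Definition idz_mul (x y : B) : B := (x.1 * y.1, x.1 *: y.2 + y.1 *: x.2).

Lemma idz_mulA : associative idz_mul.
Proof.
move=> [r u] [s v] [t w]; congr pair; rewrite /= ?mulrA //.
by rewrite !scalerDr !scalerA addrA [t * r]mulrC [t * s]mulrC.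
Qed.
Lemma idz_mulC : commutative idz_mul.
Proof. by move=> [r u] [s v]; congr pair; [exact: mulrC|exact: addrC]. Qed.
Lemma idz_mul1 : left_id idz_one idz_mul.
Proof.
by move=> [r u]; congr pair; rewrite /= ?mul1r // scale1r scaler0 addr0.
Qed.
Lemma idz_mulDl : left_distributive idz_mul +%R.
Proof.
move=> [r u] [s v] [t w]; congr pair; rewrite /= ?mulrDl //.
by rewrite scalerDl scalerDr addrACA.
Qed.
Lemma idz_oner_neq0 : idz_one != 0.
Proof. by apply/eqP => -[/eqP]; rewrite oner_eq0. Qed.

HB.instance Definition _ := GRing.Zmodule_isComNzRing.Build B
  idz_mulA idz_mulC idz_mul1 idz_mulDl idz_oner_neq0.

Definition idz_scale (c : k) (x : B) : B := (c *: x.1, c%:A *: x.2).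

Lemma idz_scalerA a b x :
  idz_scale a (idz_scale b x) = idz_scale (a * b) x.
Proof.
by case: x => r u; rewrite /idz_scale /= !scalerA -scalerAl mul1r scalerA.
Qed.
Lemma idz_scale1r : left_id 1 idz_scale.
Proof. by case=> r u; rewrite /idz_scale /= !scale1r. Qed.
Lemma idz_scalerDr : right_distributive idz_scale +%R.
Proof. by move=> a [r u] [s v]; rewrite /idz_scale /= !scalerDr. Qed.
Lemma idz_scalerDl x : {morph idz_scale^~ x : a b / a + b}.
Proof. by case: x => r u a b; rewrite /idz_scale /= !scalerDl. Qed.

HB.instance Definition _ := GRing.Zmodule_isLmodule.Build k B
  idz_scalerA idz_scale1r idz_scalerDr idz_scalerDl.

Lemma idz_scalerAl (c : k) (x y : B) : c *: (x * y) = (c *: x) * y.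
Proof.
case: x y => [r u] [s v]; congr pair; rewrite /= ?scalerAl //.
by rewrite scalerDr !scalerA -!scalerAl !mul1r [s * _]mulrC -scalerAl mul1r.
Qed.

HB.instance Definition _ := GRing.Lmodule_isLalgebra.Build k B idz_scalerAl.
HB.instance Definition _ := GRing.Lalgebra_isComAlgebra.Build k B.

End Idealization.

Definition idealization_deg (k : fieldType) (A : comAlgType k) (M : lmodType A)
    (gA : nat -> A -> Prop) (gM : int -> M -> Prop) (d : nat)
    (x : idealization M) : Prop :=
  gA d x.1 /\ gM d%:Z x.2.

Definition is_basis (k : fieldType) (V : lmodType k) (W : V -> Prop) (m : nat)
    (b : 'I_m -> V) : Prop :=
  (forall v, W v <-> exists c : 'I_m -> k, v = \sum_i c i *: b i) /\
  (forall c : 'I_m -> k, \sum_i c i *: b i = 0 -> forall i, c i = 0).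

Definition has_dim (k : fieldType) (V : lmodType k) (W : V -> Prop) (m : nat) :
    Prop := exists b : 'I_m -> V, is_basis W b.

(* The predicate g d cuts out the homogeneous component of degree d. *)
Definition graded_algebra (k : fieldType) (B : comAlgType k)
    (g : nat -> B -> Prop) : Prop :=
  [/\ (forall d, g d 0 /\ forall (c : k) u v, g d u -> g d v -> g d (c *: u + v)),
      (forall b, exists N (c : nat -> B),
         (forall d, g d (c d)) /\ b = \sum_(d < N) c d),
      (forall N (c : nat -> B), (forall d, g d (c d)) ->
         \sum_(d < N) c d = 0 -> forall d, (d < N)%N -> c d = 0) &
      g 0%N 1 /\ forall i j u v, g i u -> g j v -> g (i + j)%N (u * v)].

Definition standard_graded (k : fieldType) (B : comAlgType k)
    (g : nat -> B -> Prop) : Prop :=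
  [/\ graded_algebra g,
      (forall b, g 0%N b -> exists c : k, b = c%:A),
      (exists m, has_dim (g 1%N) m) &
      (forall d b, g d.+1 b -> exists2 s : seq (B * B),
         (forall q, q \in s -> g 1%N q.1 /\ g d q.2) &
         b = \sum_(q <- s) q.1 * q.2)].

Definition is_ideal (B : comNzRingType) (I : B -> Prop) : Prop :=
  I 0 /\ forall a u v, I u -> I v -> I (a * u + v).

Definition artinian (B : comNzRingType) : Prop :=
  forall I : nat -> B -> Prop,
    (forall j, is_ideal (I j)) -> (forall j b, I j.+1 b -> I j b) ->
    exists N, forall j b, (N <= j)%N -> I N b -> I j b.

(* The annihilator of the irrelevant ideal. *)
Definition socle (k : fieldType) (B : comAlgType k) (g : nat -> B -> Prop)
    (b : B) : Prop :=
  forall d x, g d.+1 x -> x * b = 0.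

(* A standard graded Artinian algebra is Gorenstein when it is level of type 1,
   i.e. its socle is a line. *)
Definition artinian_gorenstein (k : fieldType) (B : comAlgType k)
    (g : nat -> B -> Prop) : Prop :=
  artinian B /\ has_dim (socle g) 1.

Definition hilbert_function (k : fieldType) (B : comAlgType k)
    (g : nat -> B -> Prop) (h : nat -> nat) : Prop :=
  forall d, has_dim (g d) (h d).

Definition unimodal (h : nat -> nat) : Prop :=
  exists p, (forall i j, (i <= j <= p)%N -> (h i <= h j)%N) /\
            (forall i j, (p <= i <= j)%N -> (h j <= h i)%N).

(* P holds on a nonempty Zariski-open subset of W, identified with affine
   m-space through a basis; principal open sets suffice, as every nonempty
   open set contains a nonempty principal one. *)
Definition for_general (k : fieldType) (V : lmodType k) (W P : V -> Prop) :
    Prop :=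
  forall m (b : 'I_m -> V), is_basis W b ->
    exists F : {mpoly k[m]},
      (exists c : 'I_m -> k, F.@[c] != 0) /\
      forall c : 'I_m -> k, F.@[c] != 0 -> P (\sum_i c i *: b i).

Definition mul_injective (k : fieldType) (B : comAlgType k)
    (g : nat -> B -> Prop) (i : nat) (l : B) : Prop :=
  forall u v, g i u -> g i v -> l * u = l * v -> u = v.

Definition mul_surjective (k : fieldType) (B : comAlgType k)
    (g : nat -> B -> Prop) (i : nat) (l : B) : Prop :=
  forall w, g i.+1 w -> exists2 u, g i u & l * u = w.

Definition WLP_in_degree (k : fieldType) (B : comAlgType k)
    (g : nat -> B -> Prop) (i : nat) : Prop :=
  for_general (g 1%N) (fun l => mul_injective g i l \/ mul_surjective g i l).

Definition canonical_idealization (k : fieldType) (n : nat)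
    (D : simplicial_complex 'I_n) : Type :=
  idealization (dual (face_algebra k D)).

HB.instance Definition _ (k : fieldType) (n : nat)
  (D : simplicial_complex 'I_n) :=
  GRing.ComAlgebra.on (canonical_idealization k D).

Definition canonical_idealization_deg (k : fieldType) (n : nat)
    (D : simplicial_complex 'I_n) : nat -> canonical_idealization k D -> Prop :=
  idealization_deg (@face_deg k n D)
    (shift_deg (canonical_deg (@face_deg k n D)) (- 3%:Z)).

(* The x_i map to the x_i of A(Delta), and the y_j to degree-one elements that
   generate the canonical module. *)
Definition is_presentation (k : fieldType) (n : nat)
    (D : simplicial_complex 'I_n)
    (phi : {lrmorphism {mpoly k[n + n]} -> canonical_idealization k D}) :
    Prop :=
  [/\ (forall b, exists p, phi p = b),
      (forall i, phi 'X_(lshift n i) = (face_pi D 'X_i, 0)) &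
      exists w : 'I_n -> dual (face_algebra k D),
        [/\ (forall j, phi 'X_(rshift n j) = (0, w j)),
            (forall j, canonical_idealization_deg 1 (phi 'X_(rshift n j))) &
            (forall u, exists r : 'I_n -> face_algebra k D,
               u = \sum_j r j *: w j)]].

(* Main.v *)
(* A(Delta) has the face monomials as a basis, so [R |x omega(-3)] has a
   homogeneous basis made of the face monomials (in degree |F|) and of the dual
   coordinate functionals (in degree 3 - |F|).  Everything but the Lefschetz
   statement is read off from how face monomials act on this basis.

   On an even cycle every linear form r = sum_i c_i x_i of A(Delta) is
   annihilated by sum_i (-1)^i c_i x_i, so that r : R_1 -> R_2 is singular, and
   as dim R_1 = dim R_2 some nonzero functional f on R_2 vanishes on r R_1.  For
   any linear form l = (r, u) this f shows that multiplication by l from degree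
   1 to degree 2 is not injective, since l (0, f) = 0, and not surjective, since
   f kills the first component of every product. *)
From HB Require Import structures.
Require Import Defs.
From mathcomp Require Import all_boot all_order all_algebra.
From mathcomp Require Import generic_quotient ring_quotient.
From mathcomp Require boolp.
From mathcomp.multinomials Require Import mpoly.
From mathcomp Require Import zify.

Set Implicit Arguments.
Unset Strict Implicit.
Unset Printing Implicit Defensive.

Import GRing.Theory.
Local Open Scope ring_scope.

(** * Squarefree monomials and coefficients of their multiples *)

Section FaceMonomials.
Context {n : nat}.

Definition set_mnm (F : {set 'I_n}) : 'X_{1..n} :=
  [multinom (i \in F : nat) | i < n].

Lemma set_mnmE (F : {set 'I_n}) i : set_mnm F i = (i \in F) :> nat.
Proof. by rewrite mnmE. Qed.

Lemma set_mnm_inj : injective set_mnm.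
Proof.
move=> F G /mnmP FG; apply/setP => i; move: (FG i); rewrite !set_mnmE.
by case: (i \in F); case: (i \in G).
Qed.

Lemma set_mnm_le (F G : {set 'I_n}) : (set_mnm F <= set_mnm G)%MM = (F \subset G).
Proof.
apply/mnm_lepP/subsetP => [le i iF|sub i].
  by move: (le i); rewrite !set_mnmE iF lt0b.
by rewrite !set_mnmE; case iF: (i \in F) => //; rewrite sub.
Qed.

Lemma set_mnmD (F G : {set 'I_n}) : F \subset G ->
  set_mnm G = (set_mnm F + set_mnm (G :\: F))%MM.
Proof.
move=> /subsetP sub; apply/mnmP => i; rewrite mnmDE !set_mnmE inE.
by case iF: (i \in F) => //=; rewrite sub.
Qed.

Lemma mdeg_set_mnm (F : {set 'I_n}) : mdeg (set_mnm F) = #|F|.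
Proof.
rewrite mdegE -sum1_card [RHS]big_mkcond; apply: eq_bigr => i _.
by rewrite set_mnmE; case: (i \in F).
Qed.

Lemma mpolyX_set_mnm (k : fieldType) (F : {set 'I_n}) :
  'X_[set_mnm F] = \prod_(i in F) 'X_i :> {mpoly k[n]}.
Proof.
rewrite mpolyXE_id [RHS]big_mkcond; apply: eq_bigr => i _.
by rewrite set_mnmE; case: (i \in F); rewrite ?expr1 ?expr0.
Qed.

Lemma mcoeffM_notle (k : fieldType) (p : {mpoly k[n]}) (m m' : 'X_{1..n}) :
  ~~ (m <= m')%MM -> (p * 'X_[m])@_m' = 0.
Proof.
move=> nle; apply/eqP; rewrite mcoeff_eq0 (perm_mem (msuppMX p m)).
by apply/mapP => -[u _ E]; rewrite E lem_addr in nle.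
Qed.

Lemma mcoeff_mulX_set (k : fieldType) (p : {mpoly k[n]}) (F G : {set 'I_n}) :
  ('X_[set_mnm F] * p)@_(set_mnm G) =
  if F \subset G then p@_(set_mnm (G :\: F)) else 0.
Proof.
rewrite mulrC; case: ifP => FG; first by rewrite (set_mnmD FG) mcoeffMX.
by apply: mcoeffM_notle; rewrite set_mnm_le FG.
Qed.

End FaceMonomials.

(** * Face coefficients on the face algebra *)

Section FaceAlgebra.
Context {k : fieldType} {n : nat} {D : simplicial_complex 'I_n}.
Local Notation R := (face_algebra k D).
Local Notation face := {F : {set 'I_n} | F \in faces D}.

Lemma ideal_gen_mul (A : comNzRingType) (G : A -> Prop) (a p : A) :
  ideal_gen G p -> ideal_gen G (a * p).
Proof.
case=> s sG ->; exists [seq (a * q.1, q.2) | q <- s].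
  by move=> q /mapP[r rs ->]; exact: sG rs.
by rewrite mulr_sumr big_map; apply: eq_bigr => q _; rewrite mulrA.
Qed.

Lemma ideal_gen_id (A : comNzRingType) (G : A -> Prop) (p : A) :
  G p -> ideal_gen G p.
Proof.
move=> Gp; exists [:: (1, p)]; first by move=> q; rewrite inE => /eqP->.
by rewrite big_seq1 mul1r.
Qed.

(** The ideal is monomial: no generator divides a face monomial, whereas any other monomial is a
    multiple of a generator, being divisible by a square or squarefree with a nonface as support. *)
Lemma mem_face_ideal (p : {mpoly k[n]}) :
  p \in face_ideal k D <-> forall F, F \in faces D -> p@_(set_mnm F) = 0.
Proof.
split.
  move=> /boolp.asboolP[s sG ->] F FD; rewrite raddf_sum big_seq big1 // => q /sG.
  case=> [[i ->]|[t tG ->]].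
    rewrite mpolyXn; apply: mcoeffM_notle; apply/mnm_lepP => /(_ i).
    by rewrite mulmnE mnm1E eqxx set_mnmE; case: (i \in F).
  rewrite mulr_sumr raddf_sum big_seq big1 // => r /tG[G GD ->].
  rewrite mulrA -mpolyX_set_mnm; apply: mcoeffM_notle; rewrite set_mnm_le.
  by apply: contraNN GD => GF; exact: faces_sub GF FD.
move=> p0; rewrite [p]mpolyE big_seq.
apply: (big_ind (fun p => p \in face_ideal k D)).
- exact: rpred0.
- by move=> ? ?; exact: rpredD.
move=> m mp; rewrite -mul_mpolyC; apply/boolp.asboolP/ideal_gen_mul.
have [/existsP[i mi]|nsq] := boolP [exists i, 1 < m i]%N.
  have le2 : (U_(i) *+ 2 <= m)%MM.
    by apply/mnm_lepP => j; rewrite mulmnE mnm1E; case: eqP => // <-.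
  rewrite -(submK le2) mpolyXD; apply/ideal_gen_mul/ideal_gen_id.
  by left; exists i; rewrite mpolyXn.
have E : m = set_mnm [set i | m i == 1%N].
  apply/mnmP => i; rewrite set_mnmE inE.
  move/existsPn: nsq => /(_ i); rewrite -leqNgt.
  by case: (m i) => [|[|?]].
rewrite E; apply: ideal_gen_id; right; apply: ideal_gen_id.
exists [set i | m i == 1%N]; last exact: mpolyX_set_mnm.
(* The support is a nonface, since otherwise [p0] would make the coefficient at [m] vanish although
   [m] occurs in [p]. *)
apply/negP => /p0/eqP; rewrite -E; apply/negP.
by rewrite -mcoeff_msupp.
Qed.

Lemma face_piE (p q : {mpoly k[n]}) : face_pi D p = face_pi D q <->
  forall F, F \in faces D -> p@_(set_mnm F) = q@_(set_mnm F).
Proof.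
have -> : face_pi D p = face_pi D q <-> p - q \in face_ideal k D.
  rewrite /face_pi Quotient.idealrBE; split=> [->//|/eqP//].
rewrite mem_face_ideal; split=> H F /H; rewrite mcoeffB.
  by move/eqP; rewrite subr_eq0 => /eqP.
by move->; rewrite subrr.
Qed.

Lemma face_piW (x : R) : exists p, x = face_pi D p.
Proof. by exists (repr (x : {ideal_quot face_ideal k D})); rewrite /face_pi reprK. Qed.

(** The coefficient is read off a chosen representative; [face_coef_pi] shows that the choice does
    not matter. *)
Definition face_coef_fun (F : face) (x : R) : k^o :=
  (repr (x : {ideal_quot face_ideal k D}))@_(set_mnm (val F)).

Lemma face_coef_pi F p : face_coef_fun F (face_pi D p) = p@_(set_mnm (val F)).
Proof.
have /face_piE : face_pi D (repr (face_pi D p : {ideal_quot face_ideal k D})) = face_pi D p.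
  by rewrite /face_pi reprK.
by apply; exact: valP.
Qed.

Lemma face_piM p q : face_pi D (p * q) = face_pi D p * face_pi D q :> R.
Proof. exact: rmorphM. Qed.
Lemma face_piD p q : face_pi D (p + q) = face_pi D p + face_pi D q :> R.
Proof. exact: rmorphD. Qed.
Lemma face_piZ c p : face_pi D (c *: p) = c *: (face_pi D p : R).
Proof. by symmetry; exact: (@quot_scaleE k {mpoly k[n]} (face_ideal k D) c p). Qed.
Lemma face_pi1 : face_pi D 1 = 1 :> R.
Proof. exact: rmorph1. Qed.
Lemma face_pi0 : face_pi D 0 = 0 :> R.
Proof. exact: rmorph0. Qed.
Lemma face_pi_sum (I : Type) (r : seq I) P (G : I -> {mpoly k[n]}) :
  face_pi D (\sum_(i <- r | P i) G i) = \sum_(i <- r | P i) (face_pi D (G i) : R).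
Proof. exact: rmorph_sum. Qed.

Lemma face_coef_linear F : linear (face_coef_fun F).
Proof.
move=> c x y; have [[p ->] [q ->]] := (face_piW x, face_piW y).
by rewrite -face_piZ -face_piD !face_coef_pi mcoeffD mcoeffZ.
Qed.

HB.instance Definition _ F :=
  GRing.isLinear.Build k R k^o _ (face_coef_fun F) (face_coef_linear F).

Definition face_coef (F : face) : dual R := face_coef_fun F : {linear R -> k^o}.

Definition face_mon (F : {set 'I_n}) : R := face_pi D 'X_[set_mnm F].

End FaceAlgebra.

(** * Algebras with a finite homogeneous basis *)

Section HomogeneousBasis.
Context {k : fieldType} {B : comAlgType k} {I : finType}.
(** The coordinates [co] are dual to [e], so that [co_basis] and [expand] make [e] a basis; [gE]
    says that degree [d] is the span of the [e i] with [dg i = d]. *)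
Variables (e : I -> B) (co : I -> B -> k) (dg : I -> nat).
Variable g : nat -> B -> Prop.
Hypothesis co_linear : forall i c x y, co i (c *: x + y) = c * co i x + co i y.
Hypothesis co_basis : forall i j, co i (e j) = (i == j)%:R.
Hypothesis expand : forall b, b = \sum_i co i b *: e i.
Hypothesis gE : forall d b, g d b <-> forall i, co i b != 0 -> dg i = d.

Let co0 i : co i 0 = 0.
Proof.
have := co_linear i 1 0 0; rewrite scale1r addr0 mul1r => /eqP.
by rewrite -[X in X == _]addr0 => /eqP/addrI.
Qed.

Let coD i x y : co i (x + y) = co i x + co i y.
Proof. by rewrite -{1}[x]scale1r co_linear mul1r. Qed.

Let coZ i c x : co i (c *: x) = c * co i x.
Proof. by rewrite -[c *: x]addr0 co_linear co0 addr0. Qed.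

Let co_sum i (J : Type) (r : seq J) (P : pred J) (F : J -> B) :
  co i (\sum_(j <- r | P j) F j) = \sum_(j <- r | P j) co i (F j).
Proof. by apply: (big_morph (co i)) => // x y; exact: coD. Qed.

Let co_comb i (P : pred I) (c : I -> k) :
  co i (\sum_(j | P j) c j *: e j) = if P i then c i else 0.
Proof.
rewrite co_sum; case: ifPn => Pi.
  rewrite (bigD1 i) //= coZ co_basis eqxx mulr1 big1 ?addr0 // => j /andP[_ ji].
  by rewrite coZ co_basis eq_sym (negPf ji) mulr0.
rewrite big1 // => j Pj; rewrite coZ co_basis; case: eqP => [E|]; last by rewrite mulr0.
by rewrite E Pj in Pi.
Qed.

Lemma homog_basis_expand d b : g d b ->
  b = \sum_(i | dg i == d) co i b *: e i.
Proof.
move/gE => gb; rewrite {1}[b]expand [RHS]big_mkcond; apply: eq_bigr => i _.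
case: eqP => // ne; have [->|/gb/ne//] := eqVneq (co i b) 0.
by rewrite scale0r.
Qed.

Lemma homog_basis_has_dim d : has_dim (g d) #|[pred i | dg i == d]|.
Proof.
pose A := [pred i | dg i == d].
have sumA (c : I -> k) : \sum_(j < #|A|) c (enum_val j) *: e (enum_val j) =
    \sum_(i | dg i == d) c i *: e i.
  by rewrite -(big_enum_val (A := A) (fun i => c i *: e i)).
exists (fun j : 'I_#|A| => e (enum_val j)); split.
  move=> v; split=> [gv|[c ->]].
    exists (fun j => co (enum_val j) v).
    by rewrite (sumA (fun i => co i v)); exact: homog_basis_expand.
  apply/gE => i; rewrite co_sum => nz; apply/eqP; apply: contraNT nz => ni; apply/eqP.
  apply: big1 => j _; rewrite coZ co_basis; case: eqP => [E|]; last by rewrite mulr0.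
  by have := enum_valP j; rewrite -E inE (negPf ni).
move=> c c0 i; have : co (enum_val i) (\sum_j c j *: e (enum_val j)) = 0.
  by rewrite c0 co0.
rewrite co_sum (bigD1 i) //= coZ co_basis eqxx mulr1 big1 ?addr0 // => j ji.
by rewrite coZ co_basis (inj_eq enum_val_inj) eq_sym (negPf ji) mulr0.
Qed.

(** These are the additive clauses of [graded_algebra]; the multiplicative one depends on the
    product and is left to [idz_graded]. *)
Lemma homog_basis_graded :
  [/\ (forall d, g d 0 /\ forall (c : k) u v, g d u -> g d v -> g d (c *: u + v)),
      (forall b, exists N (c : nat -> B),
         (forall d, g d (c d)) /\ b = \sum_(d < N) c d) &
      (forall N (c : nat -> B), (forall d, g d (c d)) ->
         \sum_(d < N) c d = 0 -> forall d, (d < N)%N -> c d = 0)].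
Proof.
split.
- move=> d; split; first by apply/gE => i; rewrite co0 eqxx.
  move=> c u v /gE gu /gE gv; apply/gE => i; rewrite co_linear => nz.
  have [u0|/gu//] := eqVneq (co i u) 0.
  by apply: gv; move: nz; rewrite u0 mulr0 add0r.
(* One more than the top degree, so that the sum over [d < N] reaches every basis element. *)
- move=> b; exists (\max_i dg i).+1.
  exists (fun d => \sum_(i | dg i == d) co i b *: e i); split.
    move=> d; apply/gE => i; rewrite (co_comb _ _ (fun i => co i b)).
    by have [//|_] := eqVneq (dg i) d; rewrite eqxx.
  rewrite [LHS]expand (partition_big (fun i => inord (dg i) : 'I_(\max_i dg i).+1) xpredT) //=.
  apply: eq_bigr => d _; apply: eq_bigl => i.
  by rewrite -val_eqE /= inordK // ltnS (leq_bigmax (F := dg)).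
- move=> N c gc s0 d dN; rewrite [c d]expand big1 // => i _.
  have [->|nz] := eqVneq (co i (c d)) 0; first by rewrite scale0r.
  have : co i (\sum_(d < N) c d) = 0 by rewrite s0 co0.
  rewrite co_sum (bigD1 (Ordinal dN)) //= big1 => [|j /eqP jd].
    by rewrite addr0 => ->; rewrite scale0r.
  apply/eqP; apply: contraT => nz'; case: jd; apply/val_inj => /=.
  by rewrite -((gE _ _).1 (gc d) i nz) -((gE _ _).1 (gc j) i nz').
Qed.

(* The number of basis elements bounds the rank of a matrix of coordinates of
   elements of an ideal; a term of the chain for which the maximal such rank is
   least coincides with all its successors. *)
Lemma fin_dim_artinian : artinian B.
Proof.
move=> J Jid Jdec.
have Jle : forall i j b, (i <= j)%N -> J j b -> J i b.
  move=> i j b; elim: j => [|j IH]; first by rewrite leqn0 => /eqP->.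
  by rewrite leq_eqVlt => /orP[/eqP->//|/IH h] /Jdec.
pose m := #|I|; pose vec (b : B) : 'rV[k]_m := \row_j co (enum_val j) b.
pose unv (v : 'rV[k]_m) : B := \sum_j v 0 j *: e (enum_val j).
have vecK b : unv (vec b) = b.
  rewrite [RHS]expand (eq_bigl (mem I)) // big_enum_val.
  by apply: eq_bigr => j _; rewrite mxE.
have Jcomb j (q : nat) (A : 'M[k]_(q, m)) (v : 'rV_m) :
    (forall i, J j (unv (row i A))) -> (v <= A)%MS -> J j (unv v).
  move=> JA /submxP[w ->]; rewrite mulmx_sum_row.
  have unvL c u u' : unv (c *: u + u') = (c%:A * unv u + unv u').
    rewrite /unv mulr_algl scaler_sumr -big_split /=.
    by apply: eq_bigr => i _; rewrite !mxE scalerDl scalerA.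
  apply: (big_ind (fun v => J j (unv v))).
  - have [J0 _] := Jid j; suff -> : unv 0 = 0 by [].
    by rewrite /unv big1 // => i _; rewrite mxE scale0r.
  - move=> u u' Ju Ju'; rewrite -[u]scale1r unvL.
    by have [_] := Jid j; apply.
  - move=> i _; rewrite -[_ *: _]addr0 unvL; have [J0 JD] := Jid j.
    apply: JD => //; suff -> : unv 0 = 0 by [].
    by rewrite /unv big1 // => l _; rewrite mxE scale0r.
pose inJ j q (A : 'M[k]_(q, m)) := forall i, J j (unv (row i A)).
(* The bound is strict, so the least such [r] is one more than the eventual dimension of the
   ideals. *)
pose bnd r := boolp.asbool (exists N, forall q (A : 'M[k]_(q, m)), inJ N q A -> \rank A < r)%N.
have exb : exists r, bnd r.
  exists m.+1; apply/boolp.asboolP; exists 0%N => q A _.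
  by rewrite ltnS rank_leq_col.
case: (ex_minnP exb) => r /boolp.asboolP[N bN] rmin.
exists N => j b Nj JNb.
(* If rank [r.-1] were not reached inside [J j], then [r.-1] would be a smaller bound. The matrix
   without rows shows that [r] is positive. *)
have [q [A [JA rA]]] : exists q (A : 'M[k]_(q, m)), inJ j q A /\ (r.-1 <= \rank A)%N.
  apply: boolp.contrapT => no.
  have r0 : (0 < r)%N.
    apply: (leq_ltn_trans _ (bN 0%N 0 _)) => //.
    by case.
  have : bnd r.-1.
    apply/boolp.asboolP; exists j => q A JA; rewrite ltnNge; apply/negP => le.
    by apply: no; exists q, A.
  by move/rmin; rewrite -ltnS prednK // ltnn.
rewrite -[b]vecK; apply: (Jcomb j q A) => //.
(* Adjoining [b] to [A] stays inside [J N], so the rank cannot grow beyond [r.-1] and [vec b] lies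
   in the row space of [A]. *)
have /bN rAb : inJ N _ (col_mx A (vec b)).
  move=> i; case: (split_ordP i) => i' ->.
    by rewrite rowKu; exact: Jle Nj (JA i').
  by rewrite rowKd row_id vecK.
have leA : (A <= col_mx A (vec b))%MS by rewrite -addsmxE addsmxSl.
have : (col_mx A (vec b) <= A)%MS.
  rewrite -(geq_leqif (mxrank_leqif_sup leA)) -ltnS.
  by apply: (leq_trans rAb); case: (r) rA.
by apply: submx_trans; rewrite -addsmxE addsmxSr.
Qed.

End HomogeneousBasis.

Arguments dual_app : simpl never.

(** * Evaluation of functionals *)

Section DualApp.
Context {k : fieldType} {A : comAlgType k}.
Implicit Types (f h : dual A) (x y : A).

Lemma dual_app0 f : dual_app f 0 = 0.
Proof. exact: (linear0 (f : {linear A -> k^o})). Qed.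

Lemma dual_appP f c x y : dual_app f (c *: x + y) = c * dual_app f x + dual_app f y.
Proof. exact: (linearP (f : {linear A -> k^o})). Qed.

Lemma dual_appZ f c x : dual_app f (c *: x) = c * dual_app f x.
Proof. by rewrite -[c *: x]addr0 dual_appP dual_app0 addr0. Qed.

Lemma dual_app_sum f (I : Type) (r : seq I) (P : pred I) (F : I -> A) :
  dual_app f (\sum_(i <- r | P i) F i) = \sum_(i <- r | P i) dual_app f (F i).
Proof.
apply: (big_morph (dual_app f) _ (dual_app0 f)) => x y.
by rewrite -{1}[x]scale1r dual_appP mul1r.
Qed.

Lemma dual_scale_app f x y : dual_app (x *: f) y = dual_app f (x * y).
Proof. by []. Qed.

Lemma dual_add_app f h x : dual_app (f + h) x = dual_app f x + dual_app h x.
Proof. by []. Qed.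

Lemma dual_sum_app (I : Type) (r : seq I) (P : pred I) (F : I -> dual A) x :
  dual_app (\sum_(i <- r | P i) F i) x = \sum_(i <- r | P i) dual_app (F i) x.
Proof. exact: (big_morph (fun f : dual A => dual_app f x)). Qed.

End DualApp.

(** * The homogeneous basis of the idealization *)

Section FaceBasis.
Context {k : fieldType} {n : nat} {D : simplicial_complex 'I_n}.
Local Notation R := (face_algebra k D).
Local Notation face := {F : {set 'I_n} | F \in faces D}.
Implicit Types (F G H : face) (S : {set 'I_n}) (x y : R).
Local Notation coef F := (dual_app (@face_coef k n D F)).
Local Notation mon S := (@face_mon k n D S).

Lemma face_coefE F p : coef F (face_pi D p) = p@_(set_mnm (val F)).
Proof. exact: face_coef_pi. Qed.

Lemma face_coef_monM F G S x : S \subset val F -> val G = val F :\: S ->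
  coef F (mon S * x) = coef G x.
Proof.
move=> SF FG; have [p ->] := face_piW x.
by rewrite -face_piM !face_coefE mcoeff_mulX_set SF FG.
Qed.

Lemma face_coef_monM0 F S x : ~~ (S \subset val F) -> coef F (mon S * x) = 0.
Proof.
move=> /negPf SF; have [p ->] := face_piW x.
by rewrite -face_piM !face_coefE mcoeff_mulX_set SF.
Qed.

Lemma face_coef_mon F G : coef F (mon (val G)) = (F == G)%:R.
Proof. by rewrite face_coefE mcoeffX (inj_eq set_mnm_inj) eq_sym. Qed.

Lemma face_mon0 : mon set0 = 1.
Proof.
rewrite /face_mon -[RHS]face_pi1 -mpolyX0; congr (face_pi D 'X_[_]).
by apply/mnmP => i; rewrite set_mnmE inE mnm0E.
Qed.

Lemma face_monD1 S i : i \in S -> mon S = mon [set i] * mon (S :\ i).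
Proof. by move=> iS; rewrite -face_piM -mpolyXD -set_mnmD // sub1set. Qed.

Lemma face_coef_inj x y : (forall F, coef F x = coef F y) -> x = y.
Proof.
have [[p ->] [q ->]] := (face_piW x, face_piW y) => H.
by apply/face_piE => F FD; have := H (exist _ F FD); rewrite !face_coefE.
Qed.

Lemma face_expand x : x = \sum_F coef F x *: mon (val F).
Proof.
apply: face_coef_inj => G; rewrite dual_app_sum (bigD1 G) //= big1 => [|F FG].
  by rewrite dual_appZ face_coef_mon eqxx mulr1 addr0.
by rewrite dual_appZ face_coef_mon eq_sym (negPf FG) mulr0.
Qed.

Lemma dual_face_inj (f h : dual R) :
  (forall F, dual_app f (mon (val F)) = dual_app h (mon (val F))) -> f = h.
Proof.
move=> H; apply: dualP => x; rewrite [x]face_expand !dual_app_sum.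
by apply: eq_bigr => F _; rewrite !dual_appZ H.
Qed.

(** The coefficients appear as [c%:A] because [dual R] carries the structure of a module over
    [R]. *)
Lemma dual_face_expand (f : dual R) :
  f = \sum_F (dual_app f (mon (val F)))%:A *: face_coef F.
Proof.
apply: dual_face_inj => G; rewrite dual_sum_app (bigD1 G) //= big1 => [|F FG].
  rewrite dual_scale_app mulr_algl dual_appZ face_coef_mon eqxx mulr1.
  by rewrite addr0.
by rewrite dual_scale_app mulr_algl dual_appZ face_coef_mon (negPf FG) mulr0.
Qed.

Lemma face_degE d x : face_deg d x <-> forall F, coef F x != 0 -> #|val F| = d.
Proof.
split=> [[p hp ->] F|H].
  rewrite face_coefE -mcoeff_msupp -mdeg_set_mnm => /(dhomog_mf hp).
  exact.
exists (\sum_F coef F x *: 'X_[set_mnm (val F)]).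
  apply: rpred_sum => F _; have [->|/H <-] := eqVneq (coef F x) 0.
    by rewrite scale0r rpred0.
  by apply: rpredZ; rewrite dhomogX -mdeg_set_mnm.
rewrite face_pi_sum [LHS]face_expand; apply: eq_bigr => F _.
by rewrite face_piZ.
Qed.

(** Testing on face monomials suffices, since a homogeneous element is a combination of those of its
    own degree. *)
Lemma canonical_degE d (f : dual R) : canonical_deg (@face_deg k n D) d f <->
  forall F, dual_app f (mon (val F)) != 0 -> - #|val F|%:Z = d.
Proof.
split=> [H F nz|H j x /face_degE gx jd].
  apply/eqP; apply: contraNT nz => /H-> //; apply/face_degE => G.
  by rewrite face_coef_mon; have [->|_] := eqVneq G F; rewrite ?eqxx.
rewrite [x]face_expand dual_app_sum big1 // => F _; rewrite dual_appZ.
have [->|/gx Fj] := eqVneq (coef F x) 0; first by rewrite mul0r.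
have [->|/H E] := eqVneq (dual_app f (mon (val F))) 0; first by rewrite mulr0.
by rewrite -E Fj eqxx in jd.
Qed.

Local Notation B := (canonical_idealization k D).
Local Notation g := (@canonical_idealization_deg k n D).

Definition idz_basis (i : face + face) : B :=
  match i with inl F => (mon (val F), 0) | inr F => (0, face_coef F) end.

Definition idz_coord (i : face + face) (b : B) : k :=
  match i with
  | inl F => coef F b.1
  | inr F => dual_app b.2 (mon (val F))
  end.

(** The functional dual to [F] has degree $-|F|$ in $\omega$, hence $3-|F|$ after the shift. Under
    [dimD] the subtraction never truncates. *)
Definition idz_dg (i : face + face) : nat :=
  match i with inl F => #|val F| | inr F => 3 - #|val F| end.

Lemma idz_scaleE c (b : B) : c *: b = (c *: b.1, c%:A *: b.2) :> B.
Proof. by []. Qed.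

Lemma idz_mulE (b b' : B) : b * b' = (b.1 * b'.1, b.1 *: b'.2 + b'.1 *: b.2) :> B.
Proof. by []. Qed.

Lemma idz_coord_linear i c (b b' : B) :
  idz_coord i (c *: b + b') = c * idz_coord i b + idz_coord i b'.
Proof.
case: i => F /=; first exact: dual_appP.
by rewrite dual_add_app dual_scale_app mulr_algl dual_appZ.
Qed.

Lemma idz_coord_basis i j : idz_coord i (idz_basis j) = (i == j)%:R.
Proof.
case: i j => F [G|G] //=; rewrite ?dual_app0 ?face_coef_mon //.
by rewrite eq_sym.
Qed.

Lemma idz_expand (b : B) : b = \sum_i idz_coord i b *: idz_basis i.
Proof.
rewrite big_sumType /=.
have -> : \sum_F coef F b.1 *: ((mon (val F), 0) : B) = (b.1, 0) :> B.
  rewrite {2}[b.1]face_expand.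
  apply: (big_ind2 (fun (u : B) v => u = (v, 0) :> B)) => //.
    by move=> u v u' v' -> ->; congr pair; rewrite /= addr0.
  by move=> F _; rewrite idz_scaleE scaler0.
have -> : \sum_F dual_app b.2 (mon (val F)) *: ((0, face_coef F) : B) = (0, b.2) :> B.
  rewrite {2}[b.2]dual_face_expand.
  apply: (big_ind2 (fun (u : B) v => u = (0, v) :> B)) => //.
    by move=> u v u' v' -> ->; congr pair; rewrite /= addr0.
  by move=> F _; rewrite idz_scaleE scaler0.
by case: b => r u; congr pair; rewrite /= ?addr0 ?add0r.
Qed.

Hypothesis dimD : forall F, (#|val F| <= 2)%N.

Lemma idz_degE d (b : B) : g d b <-> forall i, idz_coord i b != 0 -> idz_dg i = d.
Proof.
have E F : (- #|val F|%:Z = d%:Z + - 3%:Z) <-> (3 - #|val F| = d)%N.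
  by have := dimD F; split; lia.
split=> [[/face_degE g1 /canonical_degE g2] [F|F] /= nz|H].
- exact: g1.
- by apply/E; exact: g2.
split; first by apply/face_degE => F nz; exact: (H (inl F)).
by apply/canonical_degE => F nz; apply/E; exact: (H (inr F)).
Qed.

End FaceBasis.

(** * Evaluation of polynomials in a commutative algebra *)

Section AlgebraEvaluation.
Context {k : fieldType} {m : nat} {A : comAlgType k}.
Variable h : 'I_m -> A.

Definition mpoly_eval : {mpoly k[m]} -> A := mmap (in_alg A) h.

HB.instance Definition _ := GRing.RMorphism.on mpoly_eval.

Lemma mpoly_eval_scalable : scalable mpoly_eval.
Proof. by move=> c p; rewrite /mpoly_eval mmapZ mulr_algl. Qed.

HB.instance Definition _ := GRing.isScalable.Build k {mpoly k[m]} A *:%R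
  mpoly_eval mpoly_eval_scalable.

Lemma mpoly_evalX i : mpoly_eval 'X_i = h i.
Proof. by rewrite /mpoly_eval mmapX mmap1U. Qed.

End AlgebraEvaluation.

(** * Complexes in which every face lies in an edge *)

Section EdgeComplex.
Context {k : fieldType} {n : nat} {D : simplicial_complex 'I_n}.
Local Notation R := (face_algebra k D).
Local Notation face := {F : {set 'I_n} | F \in faces D}.
Implicit Types (F G H : face) (S : {set 'I_n}) (x y : R).
Local Notation coef F := (dual_app (@face_coef k n D F)).
Local Notation mon S := (@face_mon k n D S).
Local Notation Face SD := (exist (fun S => is_true (S \in faces D)) _ SD).
Local Notation B := (canonical_idealization k D).
Local Notation g := (@canonical_idealization_deg k n D).
Local Notation basis := (@idz_basis k n D).
Local Notation dg := (@idz_dg n D).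

(** Edges are indexed by ['I_n] to give one functional for each variable $y_j$. Covering all faces
    by edges makes the dual functionals of edges generate $\omega$. *)
Variable edge : 'I_n -> face.
Hypothesis card_edge : forall j, #|val (edge j)| = 2.
Hypothesis sub_edge : forall F, exists j, val F \subset val (edge j).

Lemma edge_complex_dim F : (#|val F| <= 2)%N.
Proof. by have [j /subset_leq_card] := sub_edge F; rewrite card_edge. Qed.

Local Notation degE := (idz_degE edge_complex_dim).
Local Notation expandB := (homog_basis_expand idz_expand degE).

Lemma idz_basis_deg i : g (dg i) (basis i).
Proof.
apply/degE => j; rewrite idz_coord_basis.
by have [->|_] := eqVneq j i; rewrite ?eqxx.
Qed.

Lemma face_extend F : (#|val F| < 2)%N ->
  exists2 i, i \notin val F & exists G, val G = i |: val F.
Proof.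
move=> F2; have [j Fj] := sub_edge F.
have /properP[_ [i ij iF]] : val F \proper val (edge j).
  by rewrite properEcard Fj card_edge.
exists i => //; have GD : i |: val F \in faces D.
  by apply: faces_sub (valP (edge j)); rewrite subUset sub1set ij.
by exists (Face GD).
Qed.

Lemma face_mon1_deg i : face_deg 1 (mon [set i]).
Proof. by exists 'X_[set_mnm [set i]] => //; rewrite dhomogX /= mdeg_set_mnm cards1. Qed.

(** Contraction: the coefficient of $x_F$ in $x_S x$ is the coefficient of $x_{F\setminus S}$ in
    $x$. *)
Lemma face_mon_act S F G : S \subset val F -> val G = val F :\: S ->
  mon S *: face_coef F = face_coef G.
Proof. by move=> SF E; apply: dualP => x; rewrite dual_scale_app (face_coef_monM _ SF E). Qed.

Lemma idz_graded : graded_algebra g.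
Proof.
have [g1 g2 g3] := homog_basis_graded (@idz_coord_linear k n D) idz_coord_basis idz_expand degE.
split=> //; split.
  split; first by exists 1 => //; [exact: dhomog1|rewrite face_pi1].
  by move=> j x _ _.
move=> i j [r u] [s v] [/= gr gu] [/= gs gv].
(* Evaluating $xf$ in degree $l$ evaluates $f$ in degree $a+l$, so the action of $x$ raises the
   degree of a functional by $a$. *)
have actdeg a b (x : R) f : face_deg a x ->
    shift_deg (canonical_deg (@face_deg k n D)) (- 3%:Z) b%:Z f ->
    shift_deg (canonical_deg (@face_deg k n D)) (- 3%:Z) (a + b)%:Z (x *: f).
  move=> [p hp ->] gf l _ [q hq ->] ne; rewrite dual_scale_app -face_piM.
  apply: (gf (a + l)%N); first by exists (p * q) => //; exact: dhomogM.
  by apply: contraNneq ne => E; apply/eqP; lia.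
split=> /=.
  have [[p hp ->] [q hq ->]] := (gr, gs).
  by exists (p * q); [exact: dhomogM|rewrite face_piM].
move=> l x gx ne; rewrite dual_add_app (actdeg i j r v gr gv l x gx ne).
by rewrite addnC in ne; rewrite (actdeg j i s u gs gu l x gx ne) addr0.
Qed.

(** Each basis element of positive degree splits off a linear factor: a monomial loses one of its
    variables, and a functional of degree at least 2 is $x_i$ times the functional dual to a face
    with one more vertex. *)
Lemma idz_standard_graded : standard_graded g.
Proof.
split; first exact: idz_graded.
- move=> b /expandB ->; exists (coef (Face (faces0 D)) b.1).
  (* Functionals have degree at least 1, so only the empty monomial has degree 0. *)
  rewrite (big_pred1 (inl (Face (faces0 D)))) /= ?face_mon0 // => -[F|F] /=.
    by rewrite cards_eq0.
  by have := edge_complex_dim F; rewrite /=; case: #|_| => [|[|[|]]].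
- exists #|[pred i | dg i == 1%N]|.
  exact: homog_basis_has_dim (@idz_coord_linear k n D) idz_coord_basis idz_expand degE 1%N.
move=> d b gb.
have fac i : dg i = d.+1 -> exists pq : B * B, [/\ g 1%N pq.1, g d pq.2 & basis i = pq.1 * pq.2].
  have := idz_basis_deg i; move=> + di; rewrite di; move: di; case: i => F /= dF gF.
    have [i iF] : exists i, i \in val F by apply/set0Pn; rewrite -card_gt0 dF.
    have GD : val F :\ i \in faces D by apply: faces_sub (valP F); exact: subD1set.
    exists ((mon [set i], 0), basis (inl (Face GD))); split.
    - by split=> //; exact: face_mon1_deg.
    - have := idz_basis_deg (inl (Face GD)); rewrite /=.
      by move: dF; rewrite (cardsD1 i) iF add1n => -[->].
    - by rewrite idz_mulE /= !scaler0 addr0 -face_monD1.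
  (* A functional of degree 1 is its own linear factor, with cofactor 1. *)
  case: d gb dF gF => [|d] gb dF gF.
    exists (basis (inr F), 1); split=> //=; last by rewrite mulr1.
    by have [_ _ _ []] := idz_graded.
  have {}dF : (3 - #|val F| = d.+2)%N := dF.
  have [|i iF [G GE]] := @face_extend F; first by lia.
  exists ((mon [set i], 0), basis (inr G)); split.
  - by split=> //; exact: face_mon1_deg.
  - have {1}-> : d.+1 = dg (inr G) by rewrite /idz_dg GE cardsU1 iF; lia.
    exact: idz_basis_deg (inr G).
  - rewrite idz_mulE /= mulr0 scaler0 addr0 (@face_mon_act _ G F) // GE.
      by rewrite subsetUl.
    by rewrite setU1K.
(* The guard on the degree allows a choice of factors for all [i] at once, with the dummy value
   [(0, 0)] in the other degrees. *)
pose P i (pq : B * B) := dg i = d.+1 -> [/\ g 1%N pq.1, g d pq.2 & basis i = pq.1 * pq.2].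
have [f fP] : {f : face + face -> B * B & forall i, P i (f i)}.
  apply: boolp.choice => i; have [/fac[pq ?]|ne] := eqVneq (dg i) d.+1.
    by exists pq.
  by exists (0, 0) => E; rewrite E eqxx in ne.
exists [seq (idz_coord i b *: (f i).1, (f i).2) | i <- enum [pred i | dg i == d.+1]].
  move=> q /mapP[i]; rewrite mem_enum inE => /eqP /fP[f1 f2 _] -> /=; split=> //.
  have [lin _ _ _] := idz_graded; have [g0 gL] := lin 1%N.
  by rewrite -[_ *: _]addr0; exact: gL.
rewrite big_map big_enum /= [LHS](expandB gb); apply: eq_bigr => i /eqP/fP[_ _ ->].
by rewrite scalerAl.
Qed.

(** The socle is the line of the functional dual to the empty face, in degree 3. The pairing of $R$
    with $\omega$ excludes everything else: functionals detect the first component of an element,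
    and nonempty face monomials detect the rest of the second. *)
Lemma idz_artinian_gorenstein : artinian_gorenstein g.
Proof.
split; first exact: fin_dim_artinian (@idz_expand k n D).
pose F0 : face := Face (faces0 D).
exists (fun=> (0, face_coef F0)); split; last first.
  move=> c; rewrite big_ord1 => /(congr1 (fun b : B => dual_app b.2 1)) /=.
  rewrite dual_scale_app mulr_algl dual_appZ -face_mon0.
  rewrite (face_coef_mon F0 F0) eqxx mulr1 => c0 i.
  by rewrite (ord1 i).
move=> [r u]; split=> [soc|[c ->]].
  exists (fun=> dual_app u 1); rewrite big_ord1 idz_scaleE scaler0 /=; congr pair.
    apply: face_coef_inj => F; rewrite dual_app0.
    (* The functional dual to [F] has positive degree; its product with [(r, u)], evaluated at 1, is
       the coefficient of [r] at [F]. *)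
    have := idz_basis_deg (inr F); rewrite /= subSn ?edge_complex_dim // => /soc.
    rewrite idz_mulE /= => /(congr1 (fun b : B => dual_app b.2 1)) /=.
    by rewrite scale0r add0r dual_scale_app mulr1.
  apply: dual_face_inj => F; rewrite dual_scale_app mulr_algl dual_appZ face_coef_mon.
  have [<-|ne] := eqVneq F0 F; first by rewrite /= face_mon0 mulr1.
  rewrite mulr0; have := idz_basis_deg (inl F).
  have : (0 < #|val F|)%N.
    by rewrite card_gt0; apply: contraNneq ne => E; apply/eqP/val_inj.
  rewrite /=; case: #|_| => // d _ /soc.
  rewrite idz_mulE /= => /(congr1 (fun b : B => dual_app b.2 1)) /=.
  by rewrite scaler0 addr0 dual_scale_app mulr1.
move=> d [s v] [/= gs _]; rewrite big_ord1 -scalerAr idz_mulE /= mulr0 scale0r addr0.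
(* An element [s] of positive degree has no constant term, and [face_coef F0] reads off constant
   terms. *)
suff -> : s *: face_coef F0 = 0 :> dual R by rewrite idz_scaleE /= !scaler0.
apply: dual_face_inj => F; rewrite dual_scale_app mulrC.
have [->|ne] := eqVneq F F0.
  rewrite face_mon0 mul1r; apply: contraTeq isT => /((face_degE _ _).1 gs F0).
  by rewrite cards0.
rewrite face_coef_monM0 // subset0; apply: contraNneq ne => E.
by apply/eqP/val_inj.
Qed.


Definition presentation_gen (i : 'I_(n + n)) : B :=
  match split i with
  | inl i => (face_pi D 'X_i, 0)
  | inr j => (0, face_coef (edge j))
  end.

Lemma presentation_genl i : presentation_gen (lshift n i) = (face_pi D 'X_i, 0).
Proof. by rewrite /presentation_gen -[lshift n i]/(unsplit (inl i)) unsplitK. Qed.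

Lemma presentation_genr j : presentation_gen (rshift n j) = (0, face_coef (edge j)).
Proof. by rewrite /presentation_gen -[rshift n j]/(unsplit (inr j)) unsplitK. Qed.

(** Every face $F$ lies in some edge $e$, and contracting the functional dual to $e$ by
    $x_{e\setminus F}$ gives the one dual to $F$. Hence the images of the variables generate all
    basis elements. *)
Lemma idz_presentation :
  is_presentation (mpoly_eval presentation_gen : {lrmorphism {mpoly k[n + n]} -> B}).
Proof.
pose phi : {lrmorphism {mpoly k[n + n]} -> B} := mpoly_eval presentation_gen.
have phiX i : phi 'X_i = presentation_gen i by exact: mpoly_evalX.
have phiM p q : phi (p * q) = phi p * phi q by exact: rmorphM.
have act F : exists j, face_coef F = mon (val (edge j) :\: val F) *: face_coef (edge j).
  have [j Fj] := sub_edge F; exists j; rewrite (@face_mon_act _ (edge j) F) ?subsetDl //.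
  by rewrite setDDr setDv set0U; symmetry; apply/setIidPr.
have imS S : exists p, phi p = (mon S, 0) :> B.
  exists (\prod_(i in S) 'X_(lshift n i)).
  have -> : mon S = \prod_(i in S) (face_pi D 'X_i : R).
    by rewrite /face_mon mpolyX_set_mnm; exact: rmorph_prod.
  rewrite rmorph_prod; apply: (big_ind2 (fun (b : B) x => b = (x, 0) :> B)) => //.
    by move=> _ x _ y -> ->; rewrite idz_mulE /= !scaler0 addr0.
  by move=> i _; exact: etrans (phiX _) (presentation_genl _).
split; rewrite -/phi.
- move=> b; rewrite [b]idz_expand.
  apply: (big_ind (fun b => exists p, phi p = b)).
  + by exists 0; rewrite rmorph0.
  + by move=> _ _ [p <-] [q <-]; exists (p + q); rewrite rmorphD.
  move=> i _; have [p pE] : exists p, phi p = basis i.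
    case: i => F /=; first exact: imS.
    have [j ->] := act F; have [p pE] := imS (val (edge j) :\: val F).
    exists (p * 'X_(rshift n j)).
    rewrite phiM pE phiX presentation_genr idz_mulE /=.
    by rewrite mulr0 scaler0 addr0.
  by exists (idz_coord i b *: p); rewrite -pE; exact: linearZ.
- by move=> i; rewrite phiX presentation_genl.
exists (fun j => face_coef (edge j)); split.
- by move=> j; rewrite phiX presentation_genr.
- move=> j; rewrite phiX presentation_genr.
  by have := idz_basis_deg (inr (edge j)); rewrite /idz_dg card_edge.
move=> u; rewrite [u]dual_face_expand.
apply: (big_ind (fun u => exists r : 'I_n -> R, u = \sum_j r j *: face_coef (edge j))).
- by exists (fun=> 0); rewrite big1 // => j _; rewrite scale0r.
- move=> _ _ [r ->] [s ->]; exists (fun j => r j + s j).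
  by rewrite -big_split; apply: eq_bigr => j _; rewrite scalerDl.
move=> F _; have [j ->] := act F; rewrite scalerA.
set c := _ * _.
exists (fun i => if i == j then c else 0); rewrite (bigD1 j) //= eqxx.
by rewrite big1 ?addr0 // => i /negPf->; rewrite scale0r.
Qed.

(** A nonempty open set contains a point, so it suffices that every linear form $(r,u)$ fails; the
    functional killed by $r$ obstructs both injectivity and surjectivity. *)
Lemma idz_not_WLP :
  (forall r, face_deg 1 r ->
     exists f : dual R, [/\ f != 0, g 1%N (0, f) & r *: f = 0]) ->
  ~ WLP_in_degree g 1.
Proof.
move=> kill wlp.
have [b bP] := homog_basis_has_dim (@idz_coord_linear k n D) idz_coord_basis idz_expand degE 1.
have [P [[c Pc] /(_ c Pc)]] := wlp _ b bP.
have : g 1%N (\sum_i c i *: b i) by apply/bP.1; exists c.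
case: (\sum_i c i *: b i) => r u [/= /kill[f [f0 gf rf]] _] [inj|surj].
  have : (0, f) = 0 :> B.
    apply: (inj _ _ gf).
      by split; [exists 0; rewrite ?dhomog0 ?face_pi0|move=> j x _ _].
    by rewrite mulr0 idz_mulE /= mulr0 scale0r addr0 rf.
  by move=> /(congr1 snd)/= E; rewrite E eqxx in f0.
have [F fF] : exists F, dual_app f (mon (val F)) != 0.
  apply: boolp.contrapT => no; case/eqP: f0; apply: dual_face_inj => F.
  by apply/eqP; apply: contraT => nz; case: no; exists F.
(* A functional of degree 1 is supported on faces with two vertices. A preimage $(s,v)$ of $(x_F,0)$
   would give $x_F=rs$, hence $f(x_F)=(rf)(s)=0$. *)
have F2 : #|val F| = 2.
  have := (degE _ _).1 gf (inr F) fF; rewrite /idz_dg => E.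
  by have := edge_complex_dim F; lia.
have := idz_basis_deg (inl F); rewrite [dg _]F2 => /surj[[s v] _].
rewrite idz_mulE /= => /(congr1 fst) /= E.
by move: fF; rewrite -E -dual_scale_app rf eqxx.
Qed.

End EdgeComplex.

(** * Faces of the cycle and the singular multiplication on even cycles *)

Section Cycle.
Context {k : fieldType} {n : nat}.
Hypothesis n3 : (2 < n)%N.
Local Notation D := (cycle_complex n).
Local Notation R := (face_algebra k D).
Local Notation face := {F : {set 'I_n} | F \in faces D}.
Local Notation coef F := (dual_app (@face_coef k n D F)).
Local Notation mon S := (@face_mon k n D S).
Local Notation B := (canonical_idealization k D).
Local Notation g := (@canonical_idealization_deg k n D).
Local Notation Face SD := (exist (fun S => is_true (S \in faces D)) _ SD).
Implicit Types (F G : face).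

Lemma ordS_val (i : 'I_n) : ordS i = (if i.+1 == n then 0 else i.+1)%N :> nat.
Proof.
rewrite /=; case: eqP => [->|ne]; first by rewrite modnn.
by rewrite modn_small //; have := ltn_ord i; lia.
Qed.

Lemma ordS_neq (i : 'I_n) : ordS i != i.
Proof. by apply/eqP => /(congr1 (@nat_of_ord n)); rewrite ordS_val; case: eqP; lia. Qed.

Lemma cycle_edge_subproof (j : 'I_n) : [set j; ordS j] \in faces D.
Proof.
rewrite inE; apply/orP; right; apply/existsP; exists [set j; ordS j].
by rewrite subxx andbT; apply/imsetP; exists j.
Qed.
Definition cycle_edge j : face := Face (cycle_edge_subproof j).

Lemma cycle_vertex_subproof (i : 'I_n) : [set i] \in faces D.
Proof. by apply: faces_sub (cycle_edge_subproof i); rewrite sub1set !inE eqxx. Qed.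
Definition cycle_vertex i : face := Face (cycle_vertex_subproof i).

Lemma card_cycle_edge j : #|val (cycle_edge j)| = 2.
Proof. by rewrite cards2 eq_sym ordS_neq. Qed.

Lemma sub_cycle_edge F : exists j, val F \subset val (cycle_edge j).
Proof.
case: F => F /=; rewrite inE => /orP[/eqP->|/existsP[E /andP[/imsetP[j _ ->] FE]]].
  by exists (Ordinal (ltnW (ltnW n3))); rewrite sub0set.
by exists j.
Qed.

(** Two distinct indices of the same edge would be successors of each other, which [n3] rules
    out. *)
Lemma cycle_edge_inj : injective cycle_edge.
Proof.
move=> i j /(congr1 val)/= /setP E.
have := E i; rewrite !inE eqxx => /esym/orP[/eqP//|/eqP iSj].
have := E j; rewrite !inE eqxx => /orP[/eqP//|/eqP jSi].
have := congr1 (@nat_of_ord n) iSj; have := congr1 (@nat_of_ord n) jSi.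
by rewrite !ordS_val; do 2 case: eqP => ?; lia.
Qed.

Lemma card_cycle_faces m :
  #|[pred F : face | #|val F| == m]| = nth 0%N [:: 1; n; n]%N m.
Proof.
case: m => [|[|[|m]]] /=.
- rewrite -(card1 (Face (faces0 D))); apply: eq_card => F.
  by rewrite !inE cards_eq0.
- have vinj : injective cycle_vertex.
    by move=> i j /(congr1 val) /set1_inj.
  rewrite -[RHS]card_ord -(card_codom vinj); apply: eq_card => F.
  rewrite !inE; apply/cards1P/codomP => [[i Fi]|[i ->]]; exists i => //.
  exact: val_inj.
- rewrite -[RHS]card_ord -(card_codom cycle_edge_inj); apply: eq_card => F.
  rewrite !inE; apply/eqP/codomP => [F2|[j ->]]; last exact: card_cycle_edge.
  have [j Fj] := sub_cycle_edge F; exists j; apply/val_inj/eqP.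
  by rewrite eqEcard Fj card_cycle_edge F2.
- rewrite nth_nil; apply: eq_card0 => F; rewrite !inE.
  have := edge_complex_dim card_cycle_edge sub_cycle_edge F.
  by case: #|val F| => [|[|[|]]].
Qed.

Lemma cycle_hilbert : hilbert_function g (nth 0 [:: 1; 2 * n; 2 * n; 1])%N.
Proof.
move=> d; have dimF := edge_complex_dim card_cycle_edge sub_cycle_edge.
suff <- : #|[pred i : face + face | idz_dg i == d]| = nth 0%N [:: 1; 2 * n; 2 * n; 1]%N d.
  exact: homog_basis_has_dim (@idz_coord_linear k n D) idz_coord_basis idz_expand (idz_degE dimF) d.
rewrite -sum1_card big_sumType /= !sum1_card card_cycle_faces.
(* Degree [d] collects faces of size [d] and of size [3 - d]. Degrees above 3 are separated because
   [3 - d] would truncate to 0 there and count the empty face. *)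
have [d3|d3] := leqP d 3; last first.
  rewrite eq_card0; first by case: d d3 => [|[|[|[|d]]]] //= _; rewrite ?nth_nil.
  by move=> F; rewrite !inE; apply/eqP; move: (dimF F) => /=; lia.
have -> : #|[pred F : face | (3 - #|val F| == d)%N]| = nth 0%N [:: 1; n; n]%N (3 - d).
  rewrite -card_cycle_faces; apply: eq_card => F; rewrite !inE.
  by apply/eqP/eqP; move: (dimF F) => /=; lia.
by case: d d3 => [|[|[|[|d]]]] //= _; lia.
Qed.

(** There are as many vertices as edges, so multiplication by [r] from $R_1$ to $R_2$ has a square
    matrix. Its alternating left kernel vector makes the determinant vanish, and a kernel vector on
    the other side is the required functional. *)
Lemma even_cycle_annihilator (r : R) : ~~ odd n -> face_deg 1 r ->
  exists f : dual R, [/\ f != 0, g 1%N (0, f) & r *: f = 0].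
Proof.
move=> evn /face_degE r1.
have dimF := edge_complex_dim card_cycle_edge sub_cycle_edge.
pose c i := coef (cycle_vertex i) r.
(* Row [i] holds the coordinates of $x_i r$ in the edge monomials; column [j] has support in the two
   endpoints of edge [j]. *)
pose M : 'M[k]_n := \matrix_(i, j) coef (cycle_edge j) (mon [set i] * r).
have ME i j : M i j = if i == j then c (ordS j) else if i == ordS j then c j else 0.
  rewrite mxE; case: eqVneq => [->|ij].
    apply: face_coef_monM; rewrite ?sub1set ?inE ?eqxx //=.
    by rewrite setU1K // inE eq_sym ordS_neq.
  case: eqVneq => [->|iSj].
    apply: face_coef_monM; rewrite ?sub1set ?inE ?eqxx ?orbT //=.
    by rewrite setUC setU1K // inE ordS_neq.
  by apply: face_coef_monM0; rewrite sub1set !inE negb_or ij.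
(* Parity of [n] enters here: on the closing edge the sign passes from the odd index [n - 1] to
   0. *)
have signS (j : 'I_n) : (-1) ^+ ordS j = - (-1) ^+ j :> k.
  rewrite ordS_val -signr_odd -[in RHS]signr_odd; case: eqP => [jn|_] /=.
    have -> : odd j by rewrite -[odd j]negbK -[~~ odd j]/(odd j.+1) jn.
    by rewrite expr1 opprK.
  by case: (odd j); rewrite ?opprK.
have /eqP/det0P[v v0 vM] : \det M^T = 0.
  rewrite det_tr; apply/eqP/det0P.
  (* When all [c i] vanish the alternating vector is zero, but then so is [M], and the all-ones
     vector serves instead. *)
  have [c0|[i ci]] : (forall i, c i = 0) \/ exists i, c i != 0.
    have [/existsP|/existsPn h] := boolP [exists i, c i != 0]; first by right.
    by left => i; apply/eqP; move: (h i); rewrite negbK.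
    exists (const_mx 1).
      apply/eqP => /rowP /(_ (Ordinal (ltnW (ltnW n3)))).
      by rewrite !mxE; apply/eqP; rewrite oner_eq0.
    suff -> : M = 0 by rewrite mulmx0.
    by apply/matrixP => i j; rewrite ME !c0 !if_same mxE.
  exists (\row_i ((-1) ^+ i * c i)).
    by apply: contraNneq ci => /rowP/(_ i); rewrite !mxE => /eqP; rewrite mulf_eq0 signr_eq0.
  (* Only the rows of the endpoints [j] and [ordS j] contribute, and their terms are opposite
     multiples of [c j * c (ordS j)]. *)
  apply/rowP => j; rewrite mxE (bigD1 j) //= (bigD1 (ordS j)) ?ordS_neq //= big1.
    rewrite !ME !mxE !eqxx (negPf (ordS_neq j)) signS addr0 !mulNr.
    by rewrite mulrAC subrr.
  by move=> l /andP[lj lSj]; rewrite ME (negPf lj) (negPf lSj) mulr0.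
pose f : dual R := \sum_j (v 0 j)%:A *: face_coef (cycle_edge j).
have fE x : dual_app f x = \sum_j v 0 j * coef (cycle_edge j) x.
  by rewrite dual_sum_app; apply: eq_bigr => j _; rewrite dual_scale_app mulr_algl dual_appZ.
exists f; split.
- have [j vj] : exists j, v 0 j != 0 by apply/rV0Pn.
  apply: contraNneq vj => /(congr1 (fun f => dual_app f (mon (val (cycle_edge j))))).
  rewrite fE (bigD1 j) //= (face_coef_mon (cycle_edge j) (cycle_edge j)) eqxx mulr1.
  rewrite big1 ?addr0 => [->//|i ij].
  by rewrite (face_coef_mon _ (cycle_edge j)) (inj_eq cycle_edge_inj) (negPf ij) mulr0.
- apply/(idz_degE dimF) => -[F|F] /=; first by rewrite dual_app0 eqxx.
  rewrite fE => nz; suff -> : #|val F| = 2 by [].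
  apply/eqP; apply: contraNT nz => F2; apply/eqP; apply: big1 => j _.
  rewrite face_coef_mon; case: eqVneq => [E|_]; last by rewrite mulr0.
  by rewrite -E card_cycle_edge in F2.
apply: dual_face_inj => F; rewrite dual_scale_app mulrC fE -[RHS]/(0 : k).
(* On vertex monomials the claim is the kernel equation [vM]. For any other face [F], an edge
   coefficient of $x_F r$ is zero or a coefficient of [r] outside degree 1. *)
have [/cards1P[i ->]|F1] := boolP (#|val F| == 1%N).
  by move/rowP: vM => /(_ i); rewrite !mxE => E; rewrite -[RHS]E; apply: eq_bigr => j _; rewrite !mxE.
apply: big1 => j _; have [Fj|nFj] := boolP (val F \subset val (cycle_edge j)); last first.
  by rewrite face_coef_monM0 ?mulr0.
have GD : val (cycle_edge j) :\: val F \in faces D.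
  by apply: faces_sub (valP (cycle_edge j)); exact: subsetDl.
rewrite (@face_coef_monM _ _ _ _ (Face GD) _ _ Fj) //.
have [->|/r1/=] := eqVneq (coef (Face GD) r) 0; first by rewrite mulr0.
rewrite cardsD (setIidPr Fj) -/(val (cycle_edge j)) card_cycle_edge => E.
by case/eqP: F1; have := dimF F; lia.
Qed.

End Cycle.

Theorem mainTheorem8 (k : fieldType) (hk : [pchar k] =i pred0)
    (a n : nat) (ha : (2 <= a)%N) (hn : n = (2 * a)%N) :
  let D := cycle_complex n in
  let g := @canonical_idealization_deg k n D in
  let h := nth 0%N [:: 1; 2 * n; 2 * n; 1]%N in
  [/\ standard_graded g,
      artinian_gorenstein g,
      (exists phi : {lrmorphism {mpoly k[n + n]} -> canonical_idealization k D},
         is_presentation phi),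
      hilbert_function g h /\ unimodal h &
      ~ WLP_in_degree g 1].
Proof.
have n3 : (2 < n)%N by lia.
have evn : ~~ odd n by rewrite hn oddM.
have c2 := card_cycle_edge n3; have se := sub_cycle_edge n3.
split.
- exact: (idz_standard_graded c2 se).
- exact: (idz_artinian_gorenstein c2 se).
- by exists (mpoly_eval (presentation_gen (@cycle_edge n))); exact: (idz_presentation c2 se).
- split; first exact: cycle_hilbert.
  (* The peak is put in degree 1; beyond degree 3 the default value 0 of [nth] continues the
     descent. *)
  exists 1%N; split=> [[|[|i]] [|[|j]]|[|[|[|[|i]]]] [|[|[|[|j]]]]] //=; rewrite ?nth_nil //; lia.
- by apply: (idz_not_WLP c2 se) => r; exact: even_cycle_annihilator.
Qed.
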